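(* For any $\mathbf{u},\mathbf{v}\in\mathcal{H}$ and $\alpha>0$, the hierarchical soft thresholding operator $\mathbf{S}_\alpha:\mathcal{H}\to\mathcal{H}$ satisfies $\|\mathbf{S}_\alpha(\mathbf{u})-\mathbf{S}_\alpha(\mathbf{v})\|\le\|\mathbf{u}-\mathbf{v}\|$.
   Context: Tensor setting. $d\ge2$ and $\mathcal{H}=\mathcal{H}_1\otimes\cdots\otimes\mathcal{H}_d$ is a tensor product of separable (real) Hilbert spaces, with its canonical norm $\|\cdot\|$. $\mathbb{T}$ is a fixed binary dimension tree for $\{1,\ldots,d\}$: a collection of nonempty subsets of $\{1,\ldots,d\}$ containing the root $\{1,\ldots,d\}$, all of whose nodes with at least two elements are the disjoint union of exactly two children in $\mathbb{T}$, the leaves being the singletons. For $n\in\mathbb{T}$ put $[n]:=\{1,\ldots,d\}\setminus n$. The set of edges is $\mathbb{E}:=\{\{n,[n]\}: n\in\mathbb{T}\setminus\{\{1,\ldots,d\}\}\}$; it has $E:=2d-3$ elements, with a fixed enumeration $\{n_t,[n_t]\}$, $t=1,\ldots,E$. For $\mathbf{u}\in\mathcal{H}$, $\mathcal{M}_t(\mathbf{u}):\bigotimes_{i\in[n_t]}\mathcal{H}_i\to\bigotimes_{i\in n_t}\mathcal{H}_i$ is the Hilbert-Schmidt operator corresponding to $\mathbf{u}$ (matricization); $\mathcal{M}_t$ is a linear isometry onto the Hilbert-Schmidt operators, $\|\mathbf{u}\|=\|\mathcal{M}_t(\mathbf{u})\|_{\mathrm{HS}}$. Soft thresholding. For $\alpha>0$,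 $s_\alpha(x):=\operatorname{sgn}(x)\max\{|x|-\alpha,0\}$ for $x\in\mathbb{R}$. For a Hilbert-Schmidt operator $X$ with singular value decomposition $X=\sum_i\sigma_i\langle\cdot,v_i\rangle u_i$, $S_\alpha(X):=\sum_i s_\alpha(\sigma_i)\langle\cdot,v_i\rangle u_i$. Set $S_{t,\alpha}:=\mathcal{M}_t^{-1}\circ S_\alpha\circ\mathcal{M}_t$ and $\mathbf{S}_\alpha:=S_{E,\alpha}\circ\cdots\circ S_{1,\alpha}:\mathcal{H}\to\mathcal{H}$. *)

(* Defs.v *)
From HB Require Import structures.
From mathcomp Require Import all_boot all_order all_algebra.
From mathcomp Require Import all_classical all_reals all_analysis.

Set Implicit Arguments.
Unset Strict Implicit.
Unset Printing Implicit Defensive.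

Import Order.TTheory GRing.Theory Num.Theory.
Import numFieldNormedType.Exports.

Local Open Scope classical_set_scope.
Local Open Scope ring_scope.

HB.mixin Record CompleteNormedModule_isHilbert (R : realType) V
    of CompleteNormedModule R V := {
  inner : {dot V for idfun} ;
  inner_norm : forall x : V, inner x x = `|x| ^+ 2
}.

#[short(type="hilbertType")]
HB.structure Definition Hilbert (R : realType) :=
  {V of CompleteNormedModule_isHilbert R V & CompleteNormedModule R V}.

Definition separable_space (T : topologicalType) : Prop :=
  exists D : set T, countable D /\ dense D.

Definition lin_span (R : realType) (V : lmodType R) (S : set V) : set V :=
  [set w | exists (n : nat) (c : 'I_n -> R) (e : 'I_n -> V),
     (forall k, S (e k)) /\ w = \sum_(k < n) c k *: e k].

Definition orthonormal_basis (R : realType) (V : hilbertType R) (B : set V) :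
    Prop :=
  (forall e f : V, B e -> B f -> inner e f = (e == f)%:R) /\
  dense (lin_span B).

Section Operators.
Variables (R : realType) (U V : hilbertType R).

Definition hilbert_schmidt (X : U -> V) : Prop :=
  [/\ linear X, continuous X &
      exists B : set U, orthonormal_basis B /\
        (\esum_(e in B) (`|X e| ^+ 2)%:E < +oo)%E].

Definition orthonormal_on (W : hilbertType R) (D : set nat) (w : nat -> W) :
    Prop :=
  forall i j, D i -> D j -> inner (w i) (w j) = (i == j)%:R.

(* [\sum_i s_i <., v_i> u_i], strongly convergent. *)
Definition has_expansion (X : U -> V) (s : nat -> R) (u : nat -> V)
    (v : nat -> U) : Prop :=
  forall x : U,
    series (fun i => (s i * inner x (v i)) *: u i) @ \oo --> X x.

(* An operator of finite rank has its list of singular values padded by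
   zeros, so [u_i] and [v_i] are constrained only where [s_i != 0]. *)
Definition is_svd (X : U -> V) (s : nat -> R) (u : nat -> V)
    (v : nat -> U) : Prop :=
  [/\ forall i, 0 <= s i,
      orthonormal_on [set i | s i != 0] u,
      orthonormal_on [set i | s i != 0] v &
      has_expansion X s u v].

Definition soft (a x : R) : R := Num.sg x * Num.max (`|x| - a) 0.

(* The operator obtained does not depend on the decomposition used. *)
Definition soft_op (a : R) (X : U -> V) : U -> V :=
  xget (fun=> 0) [set Y | exists s u v,
    is_svd X s u v /\ has_expansion Y (soft a \o s) u v].

End Operators.

(* These properties determine the Hilbert tensor product of a finite family
   up to a unique unitary map compatible with elementary tensors. *)

Record tensor_product (R : realType) (I : finType) (H : I -> hilbertType R) :=
  TensorProduct {
    tensor_space :> hilbertType R ;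
    pure : (forall i, H i) -> tensor_space ;
    pure_linear : forall (x : forall i, H i) (i : I),
      linear (fun y : H i => pure (@dfwith I H x i y)) ;
    pure_inner : forall x y : forall i, H i,
      inner (pure x) (pure y) = \prod_i inner (x i) (y i) ;
    pure_dense : dense (lin_span (range pure))
  }.

Section Matricization.
Variables (R : realType) (I : finType) (H : I -> hilbertType R).

Definition subfamily (A : {set I}) : {i : I | i \in A} -> hilbertType R :=
  fun j => H (val j).

Definition restrict_family (A : {set I}) (x : forall i, H i) :
    forall j : {i : I | i \in A}, subfamily j :=
  fun j => x (val j).

Variables (HH : tensor_product H)
  (HT : forall A : {set I}, tensor_product (@subfamily A)).

(* The unique Hilbert-Schmidt operator [X] with
   [<X (\otimes_(i \notin n) x_i), \otimes_(i \in n) x_i> = <w, \otimes_i x_i>]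
   for all [x]; it maps [\otimes_(i \notin n) H_i] to [\otimes_(i \in n) H_i]. *)
Definition matricization (n : {set I}) (w : HH) : HT (~: n)%SET -> HT n :=
  xget (fun=> 0) [set X | hilbert_schmidt X /\
    forall x : forall i, H i,
      inner (X (pure (HT (~: n)%SET) (restrict_family (A := (~: n)%SET) x)))
            (pure (HT n) (restrict_family (A := n) x))
      = inner w (pure HH x)].
Arguments matricization n w : clear implicits.

Definition dematricization (n : {set I}) (X : HT (~: n)%SET -> HT n) : HH :=
  xget 0 [set w | matricization n w = X].

Definition soft_edge (a : R) (n : {set I}) (w : HH) : HH :=
  dematricization (soft_op a (matricization n w)).

(* [soft_edge a n_E \o ... \o soft_edge a n_1] for [ns = [:: n_1; ...; n_E]]. *)
Definition hier_soft (a : R) (ns : seq {set I}) (w : HH) : HH :=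
  foldl (fun w' n => soft_edge a n w') w ns.

End Matricization.

Section DimensionTree.
Variable I : finType.
Implicit Types (T : {set {set I}}) (m n : {set I}).
Local Open Scope set_scope.

Definition children T n : {set {set I}} :=
  [set m | maxset (fun k => (k \in T) && (k \proper n)) m].

(* As children are maximal proper subnodes, every node is a descendant of
   the root, and the nodes without children are the singletons. *)
Definition dimension_tree T : Prop :=
  [/\ [set: I]%SET \in T, finset.set0 \notin T &
      forall n, n \in T -> (1 < #|n|)%N ->
        exists m1 m2, [/\ children T n = [set m1; m2],
          m1 :&: m2 = finset.set0 & m1 :|: m2 = n]].

Definition edge n : {set {set I}} := [set n; ~: n].

Definition edges T : {set {set {set I}}} :=
  [set edge n | n in T :\ [set: I]].

Definition edge_enumeration T (ns : seq {set I}) : Prop :=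
  {subset ns <= (T :\ [set: I])%SET} /\
  perm_eq [seq edge n | n <- ns] (enum (edges T)).

End DimensionTree.

(* Main.v *)
(* It suffices to treat a single edge, given by a subset [n] of the indices. The
   tensor space [W] carries a map [tau : U -> V -> W] with
   [<tau u v, tau u' v'> = <u,u'><v,v'>] and total range, where [U] and [V] are
   the tensor products over the complement of [n] and over [n]. The
   matricization of [w] is the operator [X_w] with [<X_w u, v> = <w, tau u v>].
   If [P] is the soft thresholding of [w], then [w - P] has operator norm at most
   [a], and [<k, P> <= <w - P, P>] for all [k] of operator norm at most [a]. So
   [w - P] is the metric projection of [w] onto this closed convex set, and the
   residual [w |-> P] of a projection is nonexpansive. Singular value
   decompositions exist by repeatedly subtracting a best rank-one approximation,
   which is attained by weak compactness. *)
Require Import Defs.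
From mathcomp Require Import all_boot all_order all_algebra.
From mathcomp Require Import all_classical all_reals all_analysis.
From mathcomp Require Import ring lra.
Import Order.TTheory GRing.Theory Num.Theory.
Import numFieldNormedType.Exports.
Local Open Scope ring_scope.
Local Open Scope classical_set_scope.
Set Implicit Arguments.
Unset Strict Implicit.
Unset Printing Implicit Defensive.

(** * Inner product calculus in a real Hilbert space *)

Section Inner.
Variables (R : realType) (U : hilbertType R).
Implicit Types x y z : U.

Lemma innerC x y : inner x y = inner y x.
Proof. by rewrite hermC expr0 mul1r. Qed.

Lemma innerDl x y z : inner (x + y) z = inner x z + inner y z.
Proof. by rewrite linearDl. Qed.

Lemma innerDr x y z : inner z (x + y) = inner z x + inner z y.
Proof. by rewrite linearDr. Qed.

Lemma innerNl x y : inner (- x) y = - inner x y.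
Proof. by rewrite linearNl. Qed.

Lemma innerNr x y : inner y (- x) = - inner y x.
Proof. by rewrite linearNr. Qed.

Lemma innerZl a x y : inner (a *: x) y = a * inner x y.
Proof. by rewrite linearZl_LR. Qed.

Lemma innerZr a x y : inner y (a *: x) = a * inner y x.
Proof. by rewrite linearZr_LR. Qed.

Lemma inner0l x : inner 0 x = 0.
Proof. by rewrite linear0l. Qed.

Lemma inner0r x : inner x 0 = 0.
Proof. by rewrite linear0r. Qed.

Lemma inner_suml I (r : seq I) (P : pred I) (F : I -> U) x :
  inner (\sum_(i <- r | P i) F i) x = \sum_(i <- r | P i) inner (F i) x.
Proof. by rewrite linear_sumlz. Qed.

Lemma inner_sumr I (r : seq I) (P : pred I) (F : I -> U) x :
  inner x (\sum_(i <- r | P i) F i) = \sum_(i <- r | P i) inner x (F i).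
Proof. by rewrite linear_sumr. Qed.

Definition innerE := (innerDl, innerDr, innerNl, innerNr, innerZl, innerZr).

Lemma inner_ge0 x : 0 <= inner x x.
Proof. by rewrite inner_norm sqr_ge0. Qed.

Lemma inner_eq0 x : inner x x = 0 -> x = 0.
Proof. by move/eqP; rewrite inner_norm sqrf_eq0 normr_eq0 => /eqP. Qed.

Lemma inner_inj x y : (forall z, inner x z = inner y z) -> x = y.
Proof.
move=> xy; apply/eqP; rewrite -subr_eq0; apply/eqP/inner_eq0.
by rewrite innerDl innerNl xy subrr.
Qed.

(** Cauchy-Schwarz: the squared norm of [|y| x - |x| y] factors as [2 |x| |y| (|x| |y| - <x,y>)],
    and the first factors are positive unless a vector vanishes. *)
Lemma inner_le_norm x y : inner x y <= `|x| * `|y|.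
Proof.
have [->|x0] := eqVneq x 0; first by rewrite inner0l normr0 mul0r.
have [->|y0] := eqVneq y 0; first by rewrite inner0r normr0 mulr0.
have xp : 0 < `|x| by rewrite normr_gt0.
have yp : 0 < `|y| by rewrite normr_gt0.
have := inner_ge0 (`|y| *: x - `|x| *: y).
rewrite !innerE !inner_norm (innerC y x).
set n := _ + _; have -> : n =
    2 * (`|x| * `|y|) * (`|x| * `|y| - inner x y) by rewrite /n; ring.
by rewrite pmulr_rge0 ?subr_ge0// !mulr_gt0.
Qed.

Lemma abs_inner_le x y : `|inner x y| <= `|x| * `|y|.
Proof.
rewrite ler_norml inner_le_norm andbT lerNl -innerNl.
by rewrite -(normrN x) inner_le_norm.
Qed.

Lemma normB_sqr x y : `|x - y| ^+ 2 = `|x| ^+ 2 - 2 * inner x y + `|y| ^+ 2.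
Proof. by rewrite -!inner_norm !innerE (innerC y x); ring. Qed.

Lemma parallelogram x y :
  `|x - y| ^+ 2 = 2 * `|x| ^+ 2 + 2 * `|y| ^+ 2 - `|x + y| ^+ 2.
Proof. by rewrite -!inner_norm !innerE; ring. Qed.

Lemma inner_continuousl y : continuous (fun x => inner x y).
Proof.
move=> x; apply/cvgrPdist_lt => e e0; near=> z.
rewrite -innerNl -innerDl (le_lt_trans (abs_inner_le _ _))//.
have : `|x - z| < e / (`|y| + 1).
  near: z; apply: cvgr_dist_lt; first exact: cvg_id.
  by rewrite divr_gt0// ltr_wpDl.
rewrite ltr_pdivlMr ?ltr_wpDl// => xz; apply: le_lt_trans xz.
by rewrite ler_wpM2l// lerDl.
Unshelve. all: by end_near. Qed.

Lemma cvg_inner T (F : set_system T) {FF : Filter F} (f : T -> U) x y :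
  f @ F --> x -> (fun t => inner (f t) y) @ F --> inner x y.
Proof. by move=> fx; exact: (cvg_comp _ _ fx (@inner_continuousl y x)). Qed.

(** Polarization writes the inner product through norms, which are continuous, so joint convergence
    needs no separate estimate. *)
Lemma cvg_inner2 T (F : set_system T) {FF : Filter F} (f g : T -> U) x y :
  f @ F --> x -> g @ F --> y ->
  (fun t => inner (f t) (g t)) @ F --> inner x y.
Proof.
move=> fx gy.
have polar (a b : U) : inner a b = 2^-1 * (`|a| ^+ 2 + `|b| ^+ 2 - `|a - b| ^+ 2).
  by rewrite normB_sqr; field.
rewrite polar; under eq_fun do rewrite polar.
have cvg_norm_sqr (h : T -> U) a :
    h @ F --> a -> (fun t => `|h t| ^+ 2) @ F --> `|a| ^+ 2.
  move=> ha; under eq_fun do rewrite expr2.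
  by rewrite expr2; apply: cvgM; exact: cvg_norm.
apply: cvgM; first exact: cvg_cst.
apply: cvgB; first by apply: cvgD; exact: cvg_norm_sqr.
by apply: cvg_norm_sqr; exact: cvgB.
Qed.

Lemma dense_dist (S : set U) x e :
  dense S -> 0 < e -> exists2 y, S y & `|x - y| < e.
Proof.
move=> dS e0; have [||y [xy Sy]] := dS (ball x e).
- by exists x; exact: ballxx.
- exact: ball_open.
by exists y => //; move: xy; rewrite -ball_normE.
Qed.

(** The difference [a] is orthogonal to the span, so [|a - z|^2 = |a|^2 + |z|^2] for every [z] in
    it. Hence no such [z] is closer to [a] than [|a|], which contradicts density unless [a = 0]. *)
Lemma dense_inner_inj (S : set U) x y : dense (lin_span S) ->
  (forall z, S z -> inner x z = inner y z) -> x = y.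
Proof.
move=> dS xy; set a := x - y.
have orth z : lin_span S z -> inner a z = 0.
  move=> [n [c [e [Se ->]]]]; rewrite inner_sumr big1// => i _.
  by rewrite innerZr innerDl innerNl xy// subrr mulr0.
apply/eqP; rewrite -subr_eq0 -/a; apply: contraT => a0.
have [|z /orth az] := @dense_dist _ a `|a| dS; first by rewrite normr_gt0.
rewrite -(@ltr_pXn2r _ 2)// ?nnegrE// (normB_sqr a z) az mulr0 subr0.
by rewrite ltNge lerDl sqr_ge0.
Qed.

End Inner.

(** * Riesz representation of bounded functionals *)

Section BoundedFunctionals.
Variables (R : realType) (U : hilbertType R).

(* Minimizing [|x|^2 - 2 phi x] over [S]: by the parallelogram identity a
   minimizing sequence is Cauchy. *)
Lemma riesz_sub (S : set U) (phi : U -> R) (C : R) :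
  S 0 -> (forall a x y, S x -> S y -> S (a *: x + y)) ->
  (forall a x y, S x -> S y -> phi (a *: x + y) = a * phi x + phi y) ->
  (forall x, S x -> phi x <= C * `|x|) ->
  exists2 m, closure S m & forall x, S x -> inner m x = phi x.
Proof.
move=> S0 Slin philin phiC.
pose J (x : U) : R := `|x| ^+ 2 - 2 * phi x.
have phi0 : phi 0 = 0.
  by have := philin (-1) _ _ S0 S0; rewrite scaler0 addr0 mulN1r addNr.
have phiZ a x : S x -> phi (a *: x) = a * phi x.
  by move=> Sx; have := philin a _ _ Sx S0; rewrite !addr0 phi0 addr0.
have SZ a x : S x -> S (a *: x).
  by move=> Sx; have := Slin a _ _ Sx S0; rewrite addr0.
have Jlb : has_inf [set J x | x in S].
  split; first by exists (J 0), 0.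
  (* Completing the square: [|x|^2 - 2 C |x| = (|x| - C)^2 - C^2]. *)
  exists (- C ^+ 2) => _ [x Sx <-]; rewrite /J.
  have := phiC _ Sx; have := sqr_ge0 (`|x| - C); rewrite sqrrB; nra.
pose E := inf [set J x | x in S].
have EJ x : S x -> E <= J x by move=> Sx; apply: (ge_inf Jlb.2); exists x.
have /choice[x_ x_P] : forall n : nat, exists x, S x /\ J x < E + n.+1%:R^-1.
  move=> n; have n0 : 0 < n.+1%:R^-1 :> R by rewrite invr_gt0.
  have [_ [x Sx <-] xE] := inf_adherent n0 Jlb.
  by exists x; split.
have Jpar x y : S x -> S y -> `|x - y| ^+ 2 <= 2 * (J x - E) + 2 * (J y - E).
  move=> Sx Sy; have Sz : S (2^-1 *: (1 *: x + y)) by apply/SZ/Slin.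
  have := EJ _ Sz; rewrite /J phiZ ?philin//; last exact: Slin.
  rewrite normrZ exprMn parallelogram scale1r gtr0_norm ?invr_gt0//.
  rewrite (_ : 2^-1 ^+ 2 = 4^-1); last by field.
  lra.
have cvgx : cvgn x_.
  apply/cauchy_cvgP/cauchy_ballP => e e0.
  have [N _ NP] : \forall n \near \oo, n.+1%:R^-1 < e ^+ 2 / 4 :> R.
    have e4 : 0 < e ^+ 2 / 4 by rewrite divr_gt0 ?exprn_gt0.
    by apply: (near_infty_natSinv_lt (PosNum e4)).
  exists ([set x_ n | n in [set n | (N <= n)%N]],
          [set x_ n | n in [set n | (N <= n)%N]]).
    by split; exists N => //= n Nn; exists n.
  move=> [_ _] [/= [n Nn <-] [k Nk <-]]; rewrite -ball_normE /=.
  have [Sn Jn] := x_P n; have [Sk Jk] := x_P k.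
  rewrite -(@ltr_pXn2r _ 2)// ?nnegrE// ?(ltW e0)//.
  apply: le_lt_trans (Jpar _ _ Sn Sk) _.
  have aux (p q a b c t : R) : p < c + a -> q < c + b -> a < t / 4 ->
      b < t / 4 -> 2 * (p - c) + 2 * (q - c) < t by lra.
  exact: aux Jn Jk (NP _ Nn) (NP _ Nk).
set m := lim (x_ @ \oo) in cvgx *.
exists m.
  apply: (@closed_cvg _ _ \oo _ x_ (closure S)); last exact: cvgx.
    exact: closed_closure.
  by near=> n; apply: subset_closure; have [] := x_P n.
move=> z Sz.
(* Perturbing a near-minimizer by [t z] bounds its gradient along [z]. *)
have grad n t : 2 * t * (phi z - inner (x_ n) z) <=
    t ^+ 2 * `|z| ^+ 2 + n.+1%:R^-1.
  have [Sn Jn] := x_P n.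
  have := EJ _ (Slin t _ _ Sz Sn); rewrite /J philin//.
  rewrite -inner_norm !innerE (innerC z (x_ n)) !inner_norm.
  move: Jn; rewrite /J; move: (phi z) (phi (x_ n)) (inner (x_ n) z) => p q r.
  move: (n.+1%:R^-1) => a; move: `|x_ n| `|z| => b c; clear -a b c p q r t.
  lra.
have gradl t : 2 * t * (phi z - inner m z) <= t ^+ 2 * `|z| ^+ 2.
  have cvl : (fun n => 2 * t * (phi z - inner (x_ n) z)) @ \oo -->
      2 * t * (phi z - inner m z).
    apply: cvgM; first exact: cvg_cst.
    by apply: cvgB; [exact: cvg_cst|exact: cvg_inner].
  have cvr : (fun n => t ^+ 2 * `|z| ^+ 2 + n.+1%:R^-1) @ \oo -->
      t ^+ 2 * `|z| ^+ 2 + 0.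
    by apply: cvgD; [exact: cvg_cst|exact: cvg_harmonic].
  by rewrite -[leRHS]addr0; apply: (ler_cvg_to cvl cvr); near=> n; exact: grad.
apply/eqP; rewrite -subr_eq0 -sqrf_eq0 eq_le sqr_ge0 andbT.
set g := inner m z - phi z; set k := `|z| ^+ 2 in gradl *.
have k0 : 0 <= k by exact: sqr_ge0.
have r0 : 0 < (k + 1)^-1 by rewrite invr_gt0 ltr_wpDl.
have rk : (k + 1)^-1 * (k + 1) = 1 by rewrite mulVf// gt_eqF// ltr_wpDl.
(* For [r = 1 / (k + 1)] and this [t], [gradl] reads [2 g^2 r <= g^2 r (1 - r)], which forces
   [g = 0]. Using [k + 1] keeps the denominator positive even when [z = 0]. *)
have := gradl (- g * (k + 1)^-1); rewrite -(opprB (inner m z)) -/g.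
move: (k + 1)^-1 r0 rk => r r0 rk.
rewrite exprMn sqrrN.
have -> : 2 * (- g * r) * - g = 2 * (g ^+ 2 * r) by ring.
have -> : g ^+ 2 * r ^+ 2 * k = g ^+ 2 * r * (r * (k + 1) - r) by ring.
rewrite rk mulrBr mulr1 => h.
have : 0 <= g ^+ 2 * r * r by rewrite -mulrA mulr_ge0 ?sqr_ge0// mulr_ge0 ?ltW.
move=> h1; suff : g ^+ 2 * r <= 0 by rewrite pmulr_lle0.
by move: (g ^+ 2 * r) (g ^+ 2 * r * r) h h1 => a b h h1; clear -a b h h1; lra.
Unshelve. all: by end_near. Qed.

Lemma riesz (phi : U -> R) (C : R) :
  (forall a x y, phi (a *: x + y) = a * phi x + phi y) ->
  (forall x, phi x <= C * `|x|) ->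
  exists m, forall x, inner m x = phi x.
Proof.
move=> philin phiC; have [|||x _|m _ mP] := @riesz_sub setT phi C => //.
by exists m => x; exact: mP.
Qed.

End BoundedFunctionals.

(** * Existence of orthonormal bases *)

Section OrthonormalBasis.
Variables (R : realType) (U : hilbertType R).

Lemma lin_span_lin (S : set U) a x y :
  lin_span S x -> lin_span S y -> lin_span S (a *: x + y).
Proof.
move=> [n [c [e [Se ->]]]] [m [c' [e' [Se' ->]]]].
exists (n + m)%N,
  (fun k => match fintype.split k with inl i => a * c i | inr i => c' i end),
  (fun k => match fintype.split k with inl i => e i | inr i => e' i end).
split.
  by move=> k; case: (fintype.split k).
rewrite big_split_ord scaler_sumr; congr (_ + _); apply: eq_bigr => i _.
  by have := unsplitK (inl i : 'I_n + 'I_m) => /= ->; rewrite scalerA.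
by have := unsplitK (inr i : 'I_n + 'I_m) => /= ->.
Qed.

Lemma lin_span0 (S : set U) : lin_span S 0.
Proof.
exists 0%N, (fun=> 0), (fun=> 0); split; first by case.
by rewrite big_ord0.
Qed.

Lemma lin_span_sub (S : set U) x : S x -> lin_span S x.
Proof.
move=> Sx; exists 1%N, (fun=> 1), (fun=> x); split => //.
by rewrite big_ord1 scale1r.
Qed.

(** Zorn's lemma gives a maximal orthonormal set. A vector outside the closure of its span would
    leave, after projection, a nonzero residual whose normalization enlarges the set. *)
Lemma exists_orthonormal_basis : exists B : set U, orthonormal_basis B.
Proof.
pose ortho (B : set U) :=
  forall e f : U, B e -> B f -> inner e f = (e == f)%:R.
have [F Fortho Ftot|B [Bortho Bmax]] := @Zorn_bigcup U ortho.
  move=> e f [X FX Xe] [Y FY Yf].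
  have [XY|YX] := Ftot _ _ FX FY.
    by apply: Fortho FY _ _ _ Yf; exact: XY.
  by apply: Fortho FX _ _ Xe _; exact: YX.
exists B; split => // O [x Ox] openO.
(* Representing [inner x] on the span yields the orthogonal projection [m] of [x] onto the closure
   of the span. *)
have [||||m mcl mx] := @riesz_sub R U (lin_span B) (inner x) `|x|.
- exact: lin_span0.
- exact: lin_span_lin.
- by move=> a y z _ _; rewrite innerDr innerZr.
- by move=> y _; exact: inner_le_norm.
have [xm|xm] := eqVneq x m.
  have [z [? ?]] := mcl O (open_nbhs_nbhs (conj openO (eq_ind _ O Ox _ xm))).
  by exists z.
pose z := `|x - m|^-1 *: (x - m).
have xm0 : `|x - m| != 0 by rewrite normr_eq0 subr_eq0.
have zz : inner z z = 1.
  by rewrite inner_norm /z normrZ normrV ?unitfE// normr_id mulVf// expr1n.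
have zB y : B y -> inner z y = 0.
  move=> By; rewrite /z innerZl innerDl innerNl mx ?subrr ?mulr0//.
  exact: lin_span_sub.
have nBz : ~ B z by move/zB/eqP; rewrite zz oner_eq0.
exfalso; apply: (Bmax (B `|` [set z])).
  split; first by move=> y By; left.
  by move=> sub; apply: nBz; apply: sub; right.
move=> e f [Be|->] [Bf|->].
- exact: Bortho.
- rewrite innerC zB//; have [ez|//] := eqVneq e z.
  by move: Be; rewrite ez.
- rewrite zB//; have [ez|//] := eqVneq z f.
  by move: Bf; rewrite -ez.
- by rewrite zz eqxx.
Qed.

End OrthonormalBasis.

(** * Extending maps with a prescribed Gram kernel from a total family *)

Section GramExtension.
Variables (R : realType) (U W : hilbertType R).

Lemma cvg_dominated_dist (x_ : nat -> U) (y_ : nat -> W) (x : U) (C : R) :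
  (forall m n, `|y_ m - y_ n| <= `|x_ m - x_ n| * C) ->
  x_ @ \oo --> x -> cvgn y_.
Proof.
move=> yx xcvg; apply/cauchy_cvgP/cauchy_ballP => e e0.
pose d : R := e / (2 * (`|C| + 1)).
have C0 : 0 < `|C| + 1 by rewrite ltr_wpDl.
have d0 : 0 < d by rewrite divr_gt0// mulr_gt0.
have [N _ NP] := cvgr_dist_lt _ _ xcvg _ d0.
exists ([set y_ n | n in [set n | (N <= n)%N]],
        [set y_ n | n in [set n | (N <= n)%N]]).
  by split; exists N => //= n Nn; exists n.
move=> [_ _] [/= [m Nm <-] [n Nn <-]]; rewrite -ball_normE /=.
have xmn : `|x_ m - x_ n| < d + d.
  rewrite (le_lt_trans (ler_distD x _ _))// ltrD//.
    by rewrite distrC; exact: NP.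
  exact: NP.
apply: le_lt_trans (yx _ _) _.
apply: (@le_lt_trans _ _ (`|x_ m - x_ n| * (`|C| + 1))).
  by rewrite ler_wpM2l// (le_trans (ler_norm _))// lerDl.
have -> : e = (d + d) * (`|C| + 1) by rewrite /d; field; lra.
by rewrite ltr_pM2r.
Qed.

Variables (J K : Type) (f : J -> U) (h : J -> K -> W) (G : K -> K -> R).
Hypothesis f_dense : dense (lin_span (range f)).
Hypothesis hG :
  forall j k j' k', inner (h j k) (h j' k') = inner (f j) (f j') * G k k'.

(** Formal linear combinations: [L] and [M] evaluate the same coefficients on [f] and on [h], so [M]
    does not have to be a well-defined function of the vector [L s]. *)
Let L (s : seq (R * J)) := \sum_(p <- s) p.1 *: f p.2.
Let M (s : seq (R * J)) k := \sum_(p <- s) p.1 *: h p.2 k.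

Let inner_M s k s' k' : inner (M s k) (M s' k') = inner (L s) (L s') * G k k'.
Proof.
rewrite !inner_suml mulr_suml; apply: eq_bigr => p _.
rewrite !inner_sumr mulr_suml; apply: eq_bigr => q _.
by rewrite !innerZl !innerZr hG; ring.
Qed.

Let L_approx (a : U) : exists s : nat -> seq (R * J), L \o s @ \oo --> a.
Proof.
have /choice[s sP] : forall n : nat, exists s, `|a - L s| < n.+1%:R^-1.
  move=> n; have n0 : 0 < n.+1%:R^-1 :> R by rewrite invr_gt0.
  have [_ [m [c [e [eP ->]]]] ae] := dense_dist a f_dense n0.
  have /choice[j jP] : forall i, exists j, f j = e i.
    by move=> i; have [j _ ji] := eP i; exists j.
  exists [seq (c i, j i) | i <- index_enum 'I_m].
  by rewrite /L big_map/=; under eq_bigr do rewrite jP.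
exists s; apply/cvgrPdist_lt => e e0; near=> n.
rewrite /= (lt_trans (sP n))//.
by near: n; apply: (near_infty_natSinv_lt (PosNum e0)).
Unshelve. all: by end_near. Qed.

(** The Gram identity makes the passage from [L s] to [M s k] Lipschitz, so [M] converges along any
    formal combinations whose values tend to [a]. The identity itself survives the limit. *)
Lemma gram_extension : exists t : U -> K -> W,
  (forall a k a' k', inner (t a k) (t a' k') = inner a a' * G k k') /\
  (forall j k, t (f j) k = h j k).
Proof.
have /choice[s sP] := L_approx.
pose t a k := lim ((fun n => M (s a n) k) @ \oo).
have tcvg a k : (fun n => M (s a n) k) @ \oo --> t a k.
  (* The Lipschitz constant comes from [|M s k - M s' k|^2 = |L s - L s'|^2 * G k k]. *)
  apply: (@cvg_dominated_dist (L \o s a) _ a (Num.sqrt (G k k))); last exact: sP.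
  move=> m n; rewrite -[leLHS]ger0_norm// -sqrtr_sqr.
  have -> : `|M (s a m) k - M (s a n) k| ^+ 2 =
      `|L (s a m) - L (s a n)| ^+ 2 * G k k.
    by rewrite -!inner_norm !innerE !inner_M; ring.
  by rewrite sqrtrM ?sqr_ge0// sqrtr_sqr ger0_norm.
have tG a k a' k' : inner (t a k) (t a' k') = inner a a' * G k k'.
  have lhs : (fun n => inner (L (s a n)) (L (s a' n)) * G k k') @ \oo -->
      inner (t a k) (t a' k').
    under eq_fun do rewrite -inner_M.
    exact: (cvg_inner2 (tcvg a k) (tcvg a' k')).
  have rhs : (fun n => inner (L (s a n)) (L (s a' n)) * G k k') @ \oo -->
      inner a a' * G k k'.
    by apply: cvgM; [exact: (cvg_inner2 (sP a) (sP a'))|exact: cvg_cst].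
  exact: cvg_unique lhs rhs.
(* The squared norm of [t (f j) k - h j k] vanishes because the inner products in its expansion all
   equal [inner (f j) (f j) * G k k]. *)
exists t; split => // j k; apply/eqP; rewrite -subr_eq0; apply/eqP/inner_eq0.
have th : inner (t (f j) k) (h j k) = inner (f j) (f j) * G k k.
  have hM : h j k = M [:: (1, j)] k by rewrite /M big_seq1 scale1r.
  have fL : f j = L [:: (1, j)] by rewrite /L big_seq1 scale1r.
  have lhs : (fun n => inner (L (s (f j) n)) (f j) * G k k) @ \oo -->
      inner (t (f j) k) (h j k).
    have -> : (fun n => inner (L (s (f j) n)) (f j) * G k k) =
        (fun n => inner (M (s (f j) n) k) (h j k)).
      by apply/funext => n; rewrite hM inner_M -fL.
    by apply: cvg_inner; exact: tcvg.
  have rhs : (fun n => inner (L (s (f j) n)) (f j) * G k k) @ \oo -->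
      inner (f j) (f j) * G k k.
    by apply: cvgM; [apply: cvg_inner; exact: sP|exact: cvg_cst].
  exact: cvg_unique lhs rhs.
by rewrite !innerE (innerC (h j k) (t _ _)) th tG hG; ring.
Qed.

End GramExtension.

Lemma tensor_map (R : realType) (U V W : hilbertType R) (J K : Type)
    (f : J -> U) (g : K -> V) (h : J -> K -> W) :
  dense (lin_span (range f)) -> dense (lin_span (range g)) ->
  (forall j k j' k',
    inner (h j k) (h j' k') = inner (f j) (f j') * inner (g k) (g k')) ->
  exists tau : U -> V -> W,
    (forall u v u' v', inner (tau u v) (tau u' v') = inner u u' * inner v v') /\
    (forall j k, tau (f j) (g k) = h j k).
Proof.
move=> fd gd hfg.
have [t [tG th]] := gram_extension fd hfg.
have [|tau [tauG tauE]] :=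
  @gram_extension _ _ _ _ _ g (fun k u => t u k) (fun u u' => inner u u') gd.
  by move=> k u k' u'; rewrite tG mulrC.
exists (fun u v => tau v u); split => [u v u' v'|j k].
  by rewrite tauG mulrC.
by rewrite tauE th.
Qed.

(** * Weak compactness of balls through ultrafilters *)

Lemma fmap_ultra T T' (f : T -> T') (F : set_system T) :
  UltraFilter F -> UltraFilter (f @ F).
Proof.
move=> FU; split; first exact: fmap_proper_filter.
move=> G GF FG; apply/seteqP; split => // A GA.
have [//|FnA] := in_ultra_setVsetC (f @^-1` A) FU.
exfalso; apply: (@filter_not_empty _ G _); rewrite -(setICr A).
by apply: filterI => //; exact: FG.
Qed.

Section WeakCompactness.
Variables (R : realType) (U : hilbertType R).

(** Each scalar function [inner (f t) z] lives in a compact interval and so converges along the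
    ultrafilter. The limits form a bounded linear functional of [z], and its Riesz representative is
    the weak limit. *)
Lemma weak_ultra_cvg T (F : set_system T) (FF : UltraFilter F) (f : T -> U)
    (C : R) : (forall t, `|f t| <= C) ->
  exists2 x, `|x| <= C &
    forall z, (fun t => inner (f t) z) @ F --> inner x z.
Proof.
move=> fC.
have fz t z : `|inner (f t) z| <= C * `|z|.
  by rewrite (le_trans (abs_inner_le _ _))// ler_wpM2r.
have /choice[phi phiP] : forall z, exists l : R,
    (fun t => inner (f t) z) @ F --> l.
  move=> z; have := @segment_compact R (- (C * `|z|)) (C * `|z|).
  rewrite compact_ultra => /(_ ((fun t => inner (f t) z) @ F) _ _)[||l [_ ?]].
  - exact: fmap_ultra.
  - apply: (@filterE _ F _ ((fun t => inner (f t) z) @^-1` _)) => t.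
    by rewrite /= in_itv/= -ler_norml; exact: fz.
  - by exists l.
have philin a y z : phi (a *: y + z) = a * phi y + phi z.
  have lhs : (fun t => a * inner (f t) y + inner (f t) z) @ F -->
      phi (a *: y + z).
    by under eq_fun do rewrite -innerZr -innerDr; exact: phiP.
  have rhs : (fun t => a * inner (f t) y + inner (f t) z) @ F -->
      a * phi y + phi z.
    by apply: cvgD; [apply: cvgM; [exact: cvg_cst|exact: phiP]|exact: phiP].
  exact: cvg_unique lhs rhs.
have phiC z : phi z <= C * `|z|.
  apply: (cvgr_to_le (phiP z)); apply: filterE => t.
  exact: le_trans (ler_norm _) (fz t z).
have [x xP] := riesz philin phiC.
exists x; last by move=> z; rewrite xP.
have [->|x0] := eqVneq x 0; last first.
  by have := phiC x; rewrite -xP inner_norm expr2 ler_pM2r// normr_gt0.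
(* For [x = 0] the claim is [0 <= C], read off at any point [t]; one exists since the filter is
   proper. *)
rewrite normr0; have [t _] := filter_ex (@filterT _ F _).
exact: le_trans (fC t).
Qed.

(** Equality case of Cauchy-Schwarz. The representative [m] has norm at most [M], so
    [|m - M x|^2 <= M^2 - 2 M^2 + M^2 = 0]. *)
Lemma extremal_functional (phi : U -> R) (M : R) (x : U) :
  (forall a y z, phi (a *: y + z) = a * phi y + phi z) ->
  (forall y, phi y <= M * `|y|) -> `|x| <= 1 -> 0 <= M -> phi x = M ->
  forall y, phi y = M * inner x y.
Proof.
move=> philin phiM x1 M0 phix y.
have [m mP] := riesz philin phiM.
suff -> : M * inner x y = inner m y by [].
rewrite -innerZl; congr (inner _ y); apply/eqP; rewrite eq_sym -subr_eq0.
have mM : `|m| <= M.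
  have [->|m0] := eqVneq m 0; first by rewrite normr0.
  by have := phiM m; rewrite -mP inner_norm expr2 ler_pM2r// normr_gt0.
rewrite -normr_eq0 -sqrf_eq0 eq_le sqr_ge0 andbT normB_sqr innerZr mP phix.
rewrite normrZ (ger0_norm M0).
have m2 : `|m| ^+ 2 <= M ^+ 2 by rewrite ler_pXn2r// nnegrE.
have x2 : M ^+ 2 * `|x| ^+ 2 <= M ^+ 2 * 1 by rewrite ler_wpM2l ?sqr_ge0// expr_le1.
by rewrite exprMn; lra.
Qed.

End WeakCompactness.

Lemma cvg0_of_sqr_sum_bounded (R : realType) (s : nat -> R) (C : R) :
  (forall k, \sum_(i < k) s i ^+ 2 <= C) -> s @ \oo --> 0.
Proof.
move=> sC; have cvs : cvgn (series (fun i => s i ^+ 2)).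
  apply: nondecreasing_is_cvgn.
    by apply/nondecreasing_seqP => n; rewrite /series/= big_nat_recr//= lerDl sqr_ge0.
  by exists C => _ [n _ <-]; rewrite /series/= big_mkord.
apply/cvgrPdist_lt => e e0.
have := cvgr_dist_lt _ _ (cvg_series_cvg_0 cvs) (e ^+ 2) _.
move=> /(_ _ (exprn_gt0 2 e0)); apply: filter_app; apply: filterE => n /=.
by rewrite !sub0r !normrN normrX ltr_pXn2r// nnegrE// ltW.
Qed.

(** * The abstract tensor pairing and best rank-one approximation *)

Section TensorPairing.
Variables (R : realType) (U V W : hilbertType R) (tau : U -> V -> W).
Hypothesis inner_tau :
  forall u v u' v', inner (tau u v) (tau u' v') = inner u u' * inner v v'.
Hypothesis tau_total :
  forall w, (forall u v, inner w (tau u v) = 0) -> w = 0.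

(** Bilinearity is forced by the Gram identity: the squared norm of the difference of the two sides
    expands to zero. *)
Lemma tau_linl a u u' v : tau (a *: u + u') v = a *: tau u v + tau u' v.
Proof.
apply/eqP; rewrite -subr_eq0; apply/eqP/inner_eq0.
by rewrite !innerE !inner_tau !innerE (innerC u' u); ring.
Qed.

Lemma tau_linr a u v v' : tau u (a *: v + v') = a *: tau u v + tau u v'.
Proof.
apply/eqP; rewrite -subr_eq0; apply/eqP/inner_eq0.
by rewrite !innerE !inner_tau !innerE (innerC v' v); ring.
Qed.

Lemma tau_scale a b u v : tau (a *: u) (b *: v) = (a * b) *: tau u v.
Proof.
apply/eqP; rewrite -subr_eq0; apply/eqP/inner_eq0.
by rewrite !innerE !inner_tau !innerE; ring.
Qed.

Lemma norm_tau u v : `|tau u v| = `|u| * `|v|.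
Proof.
apply/eqP; rewrite -(@eqrXn2 _ 2)// ?mulr_ge0//.
by rewrite exprMn -!inner_norm inner_tau.
Qed.

Lemma tau0l v : tau 0 v = 0.
Proof. by apply/eqP; rewrite -normr_eq0 norm_tau normr0 mul0r. Qed.

Lemma tau0r u : tau u 0 = 0.
Proof. by apply/eqP; rewrite -normr_eq0 norm_tau normr0 mulr0. Qed.

(** A maximizing sequence of pairs in the unit balls has weak limits [x] and [y] along an
    ultrafilter, and the pairing with [w] passes to the limit. *)
Lemma tau_sup_attained w : exists x y,
  [/\ `|x| <= 1, `|y| <= 1, 0 <= inner w (tau x y) &
    forall u v, inner w (tau u v) <= inner w (tau x y) * (`|u| * `|v|)].
Proof.
pose A := [set r | exists x y, [/\ `|x| <= 1, `|y| <= 1 & r = inner w (tau x y)]].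
have A0 : A 0 by exists 0, 0; rewrite !normr0 ler01 tau0l inner0r.
have Asup : has_sup A.
  split; first by exists 0.
  exists `|w| => _ [x [y [x1 y1 ->]]]; rewrite (le_trans (inner_le_norm _ _))//.
  by rewrite norm_tau ler_piMr// mulr_ile1.
pose M := sup A.
have /choice[x_ /choice[y_ xyP]] : forall n : nat, exists x y,
    [/\ `|x| <= 1, `|y| <= 1 & M - n.+1%:R^-1 < inner w (tau x y)].
  move=> n; have n0 : 0 < n.+1%:R^-1 :> R by rewrite invr_gt0.
  by have [_ [x [y [x1 y1 ->]]] Mxy] := sup_adherent n0 Asup; exists x, y.
have [F [FU Foo]] := @ultraFilterLemma nat \oo _.
have [x x1 xP] : exists2 x, `|x| <= 1 &
    forall z, (fun n => inner (x_ n) z) @ F --> inner x z.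
  by apply: weak_ultra_cvg => n; have [] := xyP n.
have [y y1 yP] : exists2 y, `|y| <= 1 &
    forall z, (fun n => inner (y_ n) z) @ F --> inner y z.
  by apply: weak_ultra_cvg => n; have [] := xyP n.
have [z _ zP] : exists2 z, `|z| <= 1 &
    forall w, (fun n => inner (tau (x_ n) (y_ n)) w) @ F --> inner z w.
  apply: weak_ultra_cvg => n; have [? ? _] := xyP n.
  by rewrite norm_tau mulr_ile1.
(* Against [tau u v] the pairing factors into two scalar sequences, whose limits multiply; totality
   then identifies the weak limit of the tensors. *)
have zE : z = tau x y.
  apply/eqP; rewrite -subr_eq0; apply/eqP/tau_total => u v.
  rewrite innerDl innerNl inner_tau; apply/eqP; rewrite subr_eq0; apply/eqP.
  have lhs : (fun n => inner (x_ n) u * inner (y_ n) v) @ F --> inner z (tau u v).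
    by under eq_fun do rewrite -inner_tau; exact: zP.
  have rhs : (fun n => inner (x_ n) u * inner (y_ n) v) @ F --> inner x u * inner y v.
    by apply: cvgM; [exact: xP|exact: yP].
  exact: cvg_unique lhs rhs.
have Mle : M <= inner w (tau x y).
  have cvr : (fun n => inner (tau (x_ n) (y_ n)) w) @ F --> inner w (tau x y).
    by rewrite innerC -zE; exact: zP.
  have cvl : (fun n => M - n.+1%:R^-1) @ F --> M - 0.
    apply: cvgB; first exact: cvg_cst.
    exact: cvg_trans (cvg_app _ Foo) cvg_harmonic.
  rewrite -[M]subr0; apply: (ler_cvg_to cvl cvr); apply: filterE => n.
  by have [_ _ /ltW] := xyP n; rewrite innerC.
have ub u v : `|u| <= 1 -> `|v| <= 1 -> inner w (tau u v) <= inner w (tau x y).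
  move=> u1 v1; apply: le_trans Mle; apply: (ub_le_sup Asup.2).
  by exists u, v.
exists x, y; split => //.
  by apply: le_trans Mle; apply: (ub_le_sup Asup.2).
move=> u v.
have [->|u0] := eqVneq u 0.
  by rewrite tau0l inner0r normr0 mul0r mulr0.
have [->|v0] := eqVneq v 0.
  by rewrite tau0r inner0r normr0 !mulr0.
have unit_norm (H : hilbertType R) (h : H) : h != 0 -> `| `|h|^-1 *: h| <= 1.
  by move=> h0; rewrite normrZ normrV ?unitfE ?normr_eq0// normr_id mulVf// normr_eq0.
have := ub _ _ (unit_norm _ _ u0) (unit_norm _ _ v0).
rewrite tau_scale innerZr -invfM mulrC ler_pdivrMr// mulr_gt0// normr_gt0//.
Qed.

(** With one vector of a maximizing pair frozen, the other maximizes a linear functional on the unit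
    ball, so [extremal_functional] yields both singular vector equations. If [s != 0], then
    [s <= s |x| |y|] forces unit norms. *)
Lemma best_rank_one w : exists (s : R) x y,
  [/\ 0 <= s, (forall u v, inner w (tau u v) <= s * (`|u| * `|v|)),
    (forall u, inner w (tau u y) = s * inner x u),
    (forall v, inner w (tau x v) = s * inner y v) &
    s != 0 -> inner x x = 1 /\ inner y y = 1].
Proof.
have [x [y [x1 y1 s0 sP]]] := tau_sup_attained w.
exists (inner w (tau x y)), x, y; split => //.
- apply: (extremal_functional (phi := fun u => inner w (tau u y))) => //.
    by move=> a u u'; rewrite tau_linl innerDr innerZr.
  move=> u; apply: le_trans (sP _ _) _; rewrite ler_wpM2l//.
  by rewrite ler_piMr.
- apply: (extremal_functional (phi := fun v => inner w (tau x v))) => //.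
    by move=> a v v'; rewrite tau_linr innerDr innerZr.
  move=> v; apply: le_trans (sP _ _) _; rewrite ler_wpM2l//.
  by rewrite ler_piMl.
move=> sn0; have sp : 0 < inner w (tau x y) by rewrite lt_neqAle eq_sym sn0.
have := sP x y; rewrite -[leLHS]mulr1 ler_pM2l// => xy1.
rewrite !inner_norm.
have xy x' y' : 0 <= x' -> x' <= 1 -> 0 <= y' -> y' <= 1 ->
    1 <= x' * y' -> x' ^+ 2 = 1 :> R.
  move=> ? ? ? ? ?; have -> : x' = 1.
    by apply/eqP; rewrite eq_le; apply/andP; split => //; nra.
  by rewrite expr1n.
by split; [apply: (xy `|x| `|y|)|apply: (xy `|y| `|x|)] => //; rewrite mulrC.
Qed.

End TensorPairing.

(** * Finite orthonormal sums and Bessel's inequality *)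

Section Orthonormal.
Variables (R : realType) (U : hilbertType R) (D : set nat) (e : nat -> U).
Hypothesis e_on : orthonormal_on D e.
Variable c : nat -> R.
Hypothesis cD : forall i, c i != 0 -> D i.

Lemma inner_orthonormal_sum n i : (i < n)%N -> D i ->
  inner (\sum_(j < n) c j *: e j) (e i) = c i.
Proof.
move=> ltin Di; rewrite inner_suml (bigD1 (Ordinal ltin))//= big1 ?addr0.
  by rewrite innerZl e_on// eqxx mulr1.
move=> j ji; rewrite innerZl; have [->|/cD Dj] := eqVneq (c j) 0.
  by rewrite mul0r.
rewrite e_on//; case: eqP => [ji'|_]; last by rewrite mulr0.
by move/eqP: ji; case; apply/val_inj.
Qed.

Lemma norm_orthonormal_sum n :
  `|\sum_(j < n) c j *: e j| ^+ 2 = \sum_(j < n) c j ^+ 2.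
Proof.
rewrite -inner_norm [in LHS]inner_sumr; apply: eq_bigr => i _.
rewrite innerZr; have [->|/cD Di] := eqVneq (c i) 0.
  by rewrite mul0r expr0n.
by rewrite inner_orthonormal_sum.
Qed.

(** The hypothesis says that each [c i] is either zero or the coefficient of [x] along [e i]. The
    zeros mask the indices where [e] is unconstrained. *)
Lemma bessel n x : (forall i, c i * inner x (e i) = c i ^+ 2) ->
  \sum_(j < n) c j ^+ 2 <= `|x| ^+ 2.
Proof.
move=> cx; have := sqr_ge0 `|x - \sum_(j < n) c j *: e j|.
rewrite normB_sqr norm_orthonormal_sum inner_sumr.
under eq_bigr do rewrite innerZr cx.
by move: (\sum_(j < n) _) (`|x| ^+ 2) => S X; lra.
Qed.

End Orthonormal.

Lemma cvg_eventually_const (V : topologicalType) (f : nat -> V)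
    (l : V) (N : nat) : (forall n, (N <= n)%N -> f n = l) -> f @ \oo --> l.
Proof.
by move=> fl; apply: cvg_near_cst; exists N => // n /= Nn; rewrite fl.
Qed.

(** * Scalar soft thresholding and residuals of projections *)

Section Soft.
Variables (R : realType) (a x : R).
Hypotheses (a0 : 0 < a) (x0 : 0 <= x).

Lemma soft_nneg : soft a x = Num.max (x - a) 0.
Proof.
rewrite /soft ger0_norm//; have [->|xn0] := eqVneq x 0.
  by rewrite sgr0 mul0r sub0r; apply/esym/max_idPr; rewrite oppr_le0 ltW.
by rewrite gtr0_sg ?mul1r// lt_neqAle eq_sym xn0.
Qed.

Lemma soft_ge0 : 0 <= soft a x.
Proof. by rewrite soft_nneg le_max lexx orbT. Qed.

Lemma soft_eq0 : x <= a -> soft a x = 0.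
Proof. by move=> xa; rewrite soft_nneg; apply/max_idPr; rewrite subr_le0. Qed.

Lemma soft_neq0 : soft a x != 0 -> soft a x = x - a.
Proof.
rewrite soft_nneg; case: (leP (x - a) 0) => [|_]; last by [].
by rewrite eqxx.
Qed.

Lemma soft_bounds : soft a x <= x /\ x - soft a x <= a.
Proof.
by rewrite soft_nneg; move: a0 x0; case: (leP (x - a) 0) => h h1 h2; split; lra.
Qed.

End Soft.

(* [P] and [P'] are the residuals of the projections of [w] and [w'] onto [K]. *)
Lemma projection_residual_nonexpansive (R : realType) (W : hilbertType R)
    (K : set W) (w P w' P' : W) :
  K (w - P) -> (forall k, K k -> inner k P <= inner (w - P) P) ->
  K (w' - P') -> (forall k, K k -> inner k P' <= inner (w' - P') P') ->
  `|P - P'| <= `|w - w'|.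
Proof.
move=> Kq hP Kq' hP'; rewrite -(@ler_pXn2r _ 2)// ?nnegrE//.
have := hP _ Kq'; have := hP' _ Kq.
have -> : w - w' = (w - P - (w' - P')) + (P - P').
  by rewrite addrACA -opprD !subrK.
move: (w - P) (w' - P') => q q' h1 h2; rewrite -!inner_norm.
have mono : 0 <= inner (q - q') (P - P') by rewrite !innerE; lra.
have := inner_ge0 (q - q').
move: (P - P') (q - q') mono => p r mono r0; rewrite !innerE (innerC p r).
move: (inner p p) (inner r p) (inner r r) mono r0 => x y z; lra.
Qed.

(** * Singular value decomposition and its soft thresholding *)

Section SingularValues.
Variables (R : realType) (U V W : hilbertType R) (tau : U -> V -> W).
Hypothesis inner_tau :
  forall u v u' v', inner (tau u v) (tau u' v') = inner u u' * inner v v'.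
Hypothesis tau_total :
  forall w, (forall u v, inner w (tau u v) = 0) -> w = 0.

Lemma exists_pairing_op : exists op : W -> U -> V,
  forall w u v, inner (op w u) v = inner w (tau u v).
Proof.
suff /choice[op opP] : forall w, exists f : U -> V,
    forall u v, inner (f u) v = inner w (tau u v) by exists op.
move=> w; suff /choice[f fP] : forall u, exists fu : V,
    forall v, inner fu v = inner w (tau u v) by exists f.
move=> u; apply: (@riesz _ _ (fun v => inner w (tau u v)) (`|w| * `|u|)).
  by move=> b v v'; rewrite (tau_linr inner_tau) innerDr innerZr.
move=> v; rewrite (le_trans (inner_le_norm _ _))//.
by rewrite (norm_tau inner_tau) mulrA.
Qed.

Variable op : W -> U -> V.
Hypothesis opE : forall w u v, inner (op w u) v = inner w (tau u v).

Lemma op_inj : injective op.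
Proof.
move=> w w' ww'; apply/eqP; rewrite -subr_eq0; apply/eqP/tau_total => u v.
by rewrite innerDl innerNl -!opE ww' subrr.
Qed.

Lemma op_tau_sum n (c : nat -> R) (v : nat -> U) (u : nat -> V) x :
  op (\sum_(i < n) c i *: tau (v i) (u i)) x =
  \sum_(i < n) (c i * inner x (v i)) *: u i.
Proof.
apply: inner_inj => z; rewrite opE !inner_suml; apply: eq_bigr => i _.
by rewrite !innerZl inner_tau (innerC (v i)); ring.
Qed.

(** The residuals [w_ n] lose [s n ^+ 2] of squared norm at each step, so [s] is square summable and
    tends to zero. As [s n] bounds the operator norm of [w_ n], the partial sums converge to
    [op w]. *)
Lemma exists_svd w : exists s u v, is_svd (op w) s u v.
Proof.
have /choice[S_ /choice[X_ /choice[Y_ SXY]]] := best_rank_one inner_tau tau_total.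
pose w_ := fix f n := if n is k.+1 then
  f k - S_ (f k) *: tau (X_ (f k)) (Y_ (f k)) else w.
pose s n := S_ (w_ n); pose x n := X_ (w_ n); pose y n := Y_ (w_ n).
have wS n : w_ n.+1 = w_ n - s n *: tau (x n) (y n) by [].
have s0 n : 0 <= s n by have [] := SXY (w_ n).
have s_bound n u v : inner (w_ n) (tau u v) <= s n * (`|u| * `|v|).
  by have [_ h _ _ _] := SXY (w_ n); exact: h.
have s_left n u : inner (w_ n) (tau u (y n)) = s n * inner (x n) u.
  by have [_ _ h _ _] := SXY (w_ n); exact: h.
have s_right n v : inner (w_ n) (tau (x n) v) = s n * inner (y n) v.
  by have [_ _ _ h _] := SXY (w_ n); exact: h.
have s_unit n : s n != 0 -> inner (x n) (x n) = 1 /\ inner (y n) (y n) = 1.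
  by have [_ _ _ _ h] := SXY (w_ n); exact: h.
(* Residuals annihilate all earlier singular vectors. For [i < n], the term subtracted at step [n]
   also vanishes on [x i], since [s n * <x n, x i> = <w_ n, tau (x i) (y n)> = 0] by induction.
   Orthogonality of the singular vectors follows from the same equation. *)
have defl n i : (i < n)%N -> s i != 0 ->
    (forall v, inner (w_ n) (tau (x i) v) = 0) /\
    (forall u, inner (w_ n) (tau u (y i)) = 0).
  elim: n i => // n IH i; rewrite ltnS leq_eqVlt => /orP[/eqP->|ltin] si.
    have [xx yy] := s_unit _ si.
    split=> z; rewrite wS innerDl innerNl innerZl inner_tau.
      by rewrite s_right xx; ring.
    by rewrite s_left yy; ring.
  have [IHx IHy] := IH _ ltin si.
  split=> z; rewrite wS innerDl innerNl innerZl inner_tau.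
    by rewrite IHx mulrA -s_left IHx; ring.
  by rewrite IHy mulrCA -s_right IHy; ring.
have on_x : orthonormal_on [set i | s i != 0] x.
  have lt i j : (i < j)%N -> s i != 0 -> s j != 0 -> inner (x i) (x j) = 0.
    move=> ij si sj; have [h _] := defl _ _ ij si.
    by have /eqP := s_left j (x i); rewrite h eq_sym mulf_eq0 (negbTE sj)
      /= innerC => /eqP.
  move=> i j si sj; case: (ltngtP i j) => [ij|ji|->].
  - exact: lt.
  - by rewrite innerC; exact: lt.
  - by have [] := s_unit _ sj.
have on_y : orthonormal_on [set i | s i != 0] y.
  have lt i j : (i < j)%N -> s i != 0 -> s j != 0 -> inner (y i) (y j) = 0.
    move=> ij si sj; have [_ h] := defl _ _ ij si.
    by have /eqP := s_right j (y i); rewrite h eq_sym mulf_eq0 (negbTE sj)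
      /= innerC => /eqP.
  move=> i j si sj; case: (ltngtP i j) => [ij|ji|->].
  - exact: lt.
  - by rewrite innerC; exact: lt.
  - by have [] := s_unit _ sj.
have wsum n : w_ n = w - \sum_(i < n) s i *: tau (x i) (y i).
  elim: n => [|n IH]; first by rewrite big_ord0 subr0.
  by rewrite wS IH big_ord_recr opprD addrA.
have energy n : `|w_ n| ^+ 2 = `|w| ^+ 2 - \sum_(i < n) s i ^+ 2.
  elim: n => [|n IH]; first by rewrite big_ord0 subr0.
  rewrite wS normB_sqr IH big_ord_recr/= innerZr s_left normrZ exprMn.
  rewrite -[`|tau _ _| ^+ 2]inner_norm inner_tau real_normK ?num_real//.
  have [->|/s_unit[-> ->]] := eqVneq (s n) 0; ring.
have s_cvg : s @ \oo --> 0.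
  apply: (@cvg0_of_sqr_sum_bounded _ _ (`|w| ^+ 2)) => k.
  by rewrite -subr_ge0 -energy sqr_ge0.
exists s, y, x; split => // z.
have op_res n : series (fun i => (s i * inner z (x i)) *: y i) n =
    op w z - op (w_ n) z.
  rewrite /series/= big_mkord -(@op_tau_sum n s x y).
  by apply: inner_inj => v; rewrite innerDl innerNl !opE wsum innerDl innerNl; ring.
apply/cvgrPdist_lt => e e0.
(* Test [s_bound] on the second vector [op (w_ n) z] and cancel its norm. *)
have op_le n : `|op (w_ n) z| <= s n * `|z|.
  have [->|o0] := eqVneq (op (w_ n) z) 0; first by rewrite normr0 mulr_ge0.
  have := s_bound n z (op (w_ n) z); rewrite -opE inner_norm expr2 mulrA.
  by rewrite ler_pM2r// normr_gt0.
have d0 : 0 < e / (`|z| + 1) by rewrite divr_gt0// ltr_wpDl.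
near=> n; rewrite op_res opprB addrC subrK (le_lt_trans (op_le n))//.
have : `|0 - s n| < e / (`|z| + 1).
  by near: n; exact: (cvgr_dist_lt _ _ s_cvg _ d0).
rewrite sub0r normrN ger0_norm// ltr_pdivlMr ?ltr_wpDl//; apply: le_lt_trans.
by rewrite ler_wpM2l// lerDl.
Unshelve. all: by end_near. Qed.

(** For [a >= 0], the operator-norm ball of radius [a], transported to the tensor space so that the
    projection takes place in [W]. *)
Definition spectral_ball (a : R) : set W :=
  [set k | forall x y, inner k (tau x y) <= a * (`|x| * `|y|)].

Lemma svd_value w s u v i : is_svd (op w) s u v -> s i != 0 ->
  inner w (tau (v i) (u i)) = s i.
Proof.
move=> [s0 on_u on_v svd] si; rewrite -opE.
have lhs : (fun n => inner (series (fun j => (s j * inner (v i) (v j)) *: u j) n)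
    (u i)) @ \oo --> inner (op w (v i)) (u i).
  by apply: cvg_inner; exact: svd.
suff rhs : (fun n => inner (series (fun j => (s j * inner (v i) (v j)) *: u j) n)
    (u i)) @ \oo --> s i by exact: cvg_unique lhs rhs.
(* A partial sum of length [n] contains the index [i] exactly when [i < n]; from then on its pairing
   with [u i] is constant. *)
apply: (@cvg_eventually_const _ _ _ i.+1) => n ltin.
rewrite /series/= big_mkord (@inner_orthonormal_sum _ _ _ _ on_u
  (fun j => s j * inner (v i) (v j)))//.
  by rewrite on_v// eqxx mulr1.
by move=> j; rewrite mulf_eq0 negb_or => /andP[].
Qed.

Lemma orthonormal_tau D (u : nat -> V) (v : nat -> U) :
  orthonormal_on D u -> orthonormal_on D v ->
  orthonormal_on D (fun i => tau (v i) (u i)).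
Proof.
move=> on_u on_v i j Di Dj; rewrite inner_tau on_u// on_v//.
by case: eqP; rewrite ?mulr1 ?mulr0.
Qed.

(** Only finitely many singular values reach [a], so [P] is a finite sum. The residual has singular
    values [min (s i) a], hence norm at most [a]. On the support of [P] they equal [a], the largest
    value that any [k] in the ball can have on [tau (v i) (u i)]. *)
Lemma soft_svd a w s u v : 0 < a -> is_svd (op w) s u v ->
  exists P, [/\ has_expansion (op P) (soft a \o s) u v,
    spectral_ball a (w - P) &
    forall k, spectral_ball a k -> inner k P <= inner (w - P) P].
Proof.
move=> a0 svd; have [s0 on_u on_v exp_w] := svd.
have on_t := orthonormal_tau on_u on_v.
pose c i := soft a (s i).
have c0 i : 0 <= c i by exact: soft_ge0.
have cs i : c i != 0 -> s i != 0.
  by apply: contraNneq => si; rewrite /c soft_eq0 ?si// ltW.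
(* Bessel's inequality for the orthonormal tensors [tau (v i) (u i)] makes the singular values
   square summable. *)
have [N _ NP] : \forall n \near \oo, s n < a.
  have s_cvg : s @ \oo --> 0.
    apply: (@cvg0_of_sqr_sum_bounded _ _ (`|w| ^+ 2)) => k.
    apply: (bessel on_t) => // i; have [->|si] := eqVneq (s i) 0.
      by rewrite mul0r expr0n.
    by rewrite (svd_value svd)// expr2.
  apply: filterS (cvgr_dist_lt _ _ s_cvg _ a0) => n.
  by rewrite sub0r normrN ger0_norm.
have cN n : (N <= n)%N -> c n = 0 by move=> Nn; rewrite /c soft_eq0// ltW// NP.
pose P := \sum_(i < N) c i *: tau (v i) (u i).
have seriesN x n : (N <= n)%N ->
    series (fun i => (c i * inner x (v i)) *: u i) n = op P x.
  move=> Nn; rewrite /P op_tau_sum /series/= (big_cat_nat (leq0n N) Nn)/= big_mkord.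
  rewrite [X in _ + X](_ : _ = 0) ?addr0//.
  rewrite big_nat_cond big1// => i /andP[/andP[Ni _] _].
  by rewrite cN// mul0r scale0r.
have exp_P x : series (fun i => (c i * inner x (v i)) *: u i) @ \oo --> op P x.
  by apply: (@cvg_eventually_const _ _ _ N) => n; exact: seriesN.
have P_tau i : c i != 0 -> inner P (tau (v i) (u i)) = c i.
  move=> ci; have ltiN : (i < N)%N by rewrite ltnNge; apply: contra ci => /cN->.
  by rewrite (inner_orthonormal_sum on_t)//; exact: cs.
exists P; split.
- exact: exp_P.
- move=> x y; rewrite innerDl innerNl -!opE.
  have cvd : (fun n => inner (\sum_(i < n) ((s i - c i) * inner x (v i)) *: u i) y)
      @ \oo --> inner (op w x - op P x) y.
    apply: cvg_inner.
    have -> : (fun n => \sum_(i < n) ((s i - c i) * inner x (v i)) *: u i) =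
      (fun n => series (fun i => (s i * inner x (v i)) *: u i) n -
                series (fun i => (c i * inner x (v i)) *: u i) n).
      apply/funext => n; rewrite /series/= !big_mkord -sumrB.
      by apply: eq_bigr => i _; rewrite -scalerBl -mulrBl.
    apply: cvgB; first exact: exp_w.
    exact: exp_P.
  rewrite -innerNl -innerDl; apply: (cvgr_to_le cvd); apply: filterE => n.
  apply: le_trans (inner_le_norm _ _) _; rewrite mulrA ler_wpM2r//.
  rewrite -(@ler_pXn2r _ 2)// ?nnegrE// ?mulr_ge0 ?(ltW a0)//.
  rewrite (norm_orthonormal_sum on_u (c := fun i => (s i - c i) * inner x (v i))).
    (* Where [s i = 0] the vector [v i] is arbitrary, so its coefficient is masked before Bessel's
       inequality is applied. *)
    pose d i := if s i == 0 then 0 else inner x (v i).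
    apply: (@le_trans _ _ (\sum_(i < n) a ^+ 2 * d i ^+ 2)).
      apply: ler_sum => i _; rewrite /d exprMn.
      have [cles scle] := soft_bounds a0 (s0 i).
      case: eqVneq => [si|si].
        have -> : c i = 0 by apply/eqP; apply: contraT => /cs; rewrite si eqxx.
        by rewrite si subr0 expr0n mul0r mulr0.
      by rewrite ler_wpM2r ?sqr_ge0// ler_pXn2r ?nnegrE ?subr_ge0// ltW.
    rewrite -mulr_sumr exprMn ler_wpM2l ?sqr_ge0//.
    apply: (bessel on_v) => i; rewrite /d; case: (eqVneq (s i) 0) => si //.
      by rewrite eqxx.
    by rewrite mul0r expr0n.
  move=> i; rewrite mulf_eq0 negb_or => /andP[+ _].
  by apply: contraNneq => si; rewrite /c si soft_eq0 ?subrr// ltW.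
move=> k Kk; rewrite [leLHS]inner_sumr [leRHS]inner_sumr.
apply: ler_sum => i _; rewrite !innerZr.
have [->|ci] := eqVneq (c i) 0; first by rewrite !mul0r.
rewrite ler_wpM2l// innerDl innerNl (svd_value svd) ?cs// P_tau//.
have -> : s i - c i = a by rewrite /c soft_neq0// subKr.
apply: le_trans (Kk _ _) _.
have unit (H : hilbertType R) (e : nat -> H) :
    orthonormal_on [set i | s i != 0] e -> `|e i| = 1.
  move=> on_e; have := on_e i i (cs _ ci) (cs _ ci); rewrite eqxx inner_norm.
  by move=> /eqP; rewrite sqrp_eq1// => /eqP.
by rewrite (unit _ _ on_u) (unit _ _ on_v) !mulr1.
Qed.

End SingularValues.

(** * Pairing operators are Hilbert-Schmidt and determined by elementary tensors *)

Section PairingOperator.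
Variables (R : realType) (U V W : hilbertType R) (tau : U -> V -> W).
Hypothesis inner_tau :
  forall u v u' v', inner (tau u v) (tau u' v') = inner u u' * inner v v'.
Variable op : W -> U -> V.
Hypothesis opE : forall w u v, inner (op w u) v = inner w (tau u v).

Lemma op_linear w : linear (op w).
Proof.
move=> a u u'; apply: inner_inj => v.
by rewrite innerDl innerZl !opE (tau_linl inner_tau) innerDr innerZr.
Qed.

Lemma norm_op_le w u : `|op w u| <= `|w| * `|u|.
Proof.
have [->|o0] := eqVneq (op w u) 0; first by rewrite normr0 mulr_ge0.
have := inner_le_norm w (tau u (op w u)); rewrite -opE inner_norm.
by rewrite (norm_tau inner_tau) expr2 mulrA ler_pM2r// normr_gt0.
Qed.

Lemma op_continuous w : continuous (op w).
Proof.
move=> u; apply/cvgrPdist_lt => e e0; near=> u'.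
have -> : op w u - op w u' = op w (u - u').
  by rewrite -scaleN1r addrC -op_linear scaleN1r addrC.
apply: le_lt_trans (norm_op_le _ _) _.
have : `|u - u'| < e / (`|w| + 1).
  near: u'; apply: cvgr_dist_lt; first exact: cvg_id.
  by rewrite divr_gt0// ltr_wpDl.
rewrite ltr_pdivlMr ?ltr_wpDl// mulrC => h; apply: le_lt_trans h.
by rewrite ler_wpM2r// lerDl.
Unshelve. all: by end_near. Qed.

(** Bessel's inequality in [W]: for [z] the sum of the [tau e (op w e)], both [<w,z>] and [<z,z>]
    equal the left-hand side, and [|w - z|^2 >= 0]. *)
Lemma op_sqr_sum_le w (B : set U) (r : seq U) : orthonormal_basis B ->
  uniq r -> {in r, forall e, B e} ->
  \sum_(e <- r) `|op w e| ^+ 2 <= `|w| ^+ 2.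
Proof.
move=> [Bon _] ur rB.
pose z := \sum_(e <- r) tau e (op w e).
have wz : inner w z = \sum_(e <- r) `|op w e| ^+ 2.
  by rewrite inner_sumr; apply: eq_bigr => e _; rewrite -opE inner_norm.
have zz : inner z z = \sum_(e <- r) `|op w e| ^+ 2.
  rewrite inner_suml; apply: eq_big_seq => e er; rewrite inner_sumr.
  rewrite (bigD1_seq e)//= big_seq_cond big1 ?addr0.
    by rewrite inner_tau Bon ?eqxx ?mul1r ?inner_norm//; exact: rB.
  move=> f /andP[fr fe]; rewrite inner_tau Bon; [|exact: rB..].
  by rewrite eq_sym (negbTE fe) mul0r.
have := inner_ge0 (w - z); rewrite !innerE zz (innerC z w) wz inner_norm.
by move: (\sum_(e <- r) _) (`|w| ^+ 2) => S T; lra.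
Qed.

Lemma op_hilbert_schmidt w : hilbert_schmidt (op w).
Proof.
split; [exact: op_linear|exact: op_continuous|].
have [B Bb] := exists_orthonormal_basis U.
exists B; split => //; apply: (@le_lt_trans _ _ (`|w| ^+ 2)%:E); last exact: ltry.
apply: ge_ereal_sup => _ [A [finA AB] <-].
rewrite fsbig_finite// sumEFin lee_fin.
apply: (op_sqr_sum_le _ Bb) => [|e]; first exact: finmap.fset_uniq.
by rewrite in_fset_set// inE => /AB.
Qed.

(** The two maps agree on the span of [f]. The set where they differ is open, so if it were nonempty
    it would meet this dense span. *)
Lemma op_unique J K (f : J -> U) (g : K -> V) w (X : U -> V) :
  dense (lin_span (range f)) -> dense (lin_span (range g)) ->
  linear X -> continuous X ->
  (forall j k, inner (X (f j)) (g k) = inner w (tau (f j) (g k))) ->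
  X = op w.
Proof.
move=> fd gd Xlin Xcont Xw.
have Xf j : X (f j) = op w (f j).
  by apply: (dense_inner_inj gd) => _ [k _ <-]; rewrite Xw opE.
have lin0 (Y : U -> V) : linear Y -> Y 0 = 0.
  by move=> /(_ (-1) 0 0); rewrite scaler0 addr0 scaleN1r addNr.
have Xspan u : lin_span (range f) u -> X u = op w u.
  move=> [n [c [e [eP ->]]]]; elim/big_rec: _ => [|i u' _ IH].
    by rewrite !lin0//; exact: op_linear.
  by have [j _ <-] := eP i; rewrite Xlin op_linear Xf IH.
apply/funext => u; apply/eqP; rewrite -subr_eq0 -normr_eq0; apply: contraT => ne.
pose gap u := `|X u - op w u|.
have gapc : continuous gap.
  by move=> u'; apply: cvg_norm; apply: cvgB; [exact: Xcont|exact: op_continuous].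
have [||u' [gu' /Xspan eu']] := fd (gap @^-1` [set r | 0 < r]).
- by exists u; rewrite /= /gap normr_gt0 -normr_eq0.
- by apply: open_comp; [move=> ? _; exact: gapc|exact: open_gt].
by move: gu'; rewrite /= /gap eu' subrr normr0 ltxx.
Qed.

End PairingOperator.

(** * Splitting a family of vectors along a set of indices *)

Section FamilySplitting.
Variables (R : realType) (I : finType) (H : I -> hilbertType R) (n : {set I}).

(** The match is on [boolP] because each branch needs the membership proof itself to index its
    subfamily. *)
Definition glue (y : forall j : {i | i \in (~: n)%SET}, subfamily H j)
    (z : forall j : {i | i \in n}, subfamily H j) (i : I) : H i :=
  match boolP (i \in n) with
  | AltTrue p => z (exist _ i p)
  | AltFalse p => y (exist _ i (etrans (finset.in_setC i n) p))
  end.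

Lemma restrict_glue_in y z : restrict_family (A := n) (glue y z) = z.
Proof.
apply/functional_extensionality_dep => -[i p]; rewrite /restrict_family /glue /=.
case: {-}_ / boolP => [p'|]; first by rewrite (bool_irrelevance p' p).
by move=> p'; exfalso; move: (p'); rewrite p.
Qed.

Lemma restrict_glue_out y z : restrict_family (A := (~: n)%SET) (glue y z) = y.
Proof.
apply/functional_extensionality_dep => -[i p]; rewrite /restrict_family /glue /=.
case: {-}_ / boolP => [p'|p']; first by exfalso; move: p; rewrite inE p'.
by congr (y (exist _ i _)); exact: bool_irrelevance.
Qed.

Lemma glue_restrict (x : forall i, H i) :
  glue (restrict_family x) (restrict_family x) = x.
Proof.
by apply/functional_extensionality_dep => i; rewrite /glue; case: {-}_ / boolP.
Qed.

Lemma prod_inner_restrict (x x' : forall i, H i) :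
  \prod_i inner (x i) (x' i) =
  (\prod_(j : {i | i \in (~: n)%SET})
     inner (restrict_family x j) (restrict_family x' j)) *
  (\prod_(j : {i | i \in n}) inner (restrict_family x j) (restrict_family x' j)).
Proof.
rewrite (bigID (mem (~: n)%SET))/= big_sub; congr (_ * _).
rewrite -(big_sub n (fun i => inner (x i) (x' i))).
by apply: eq_bigl => i; rewrite !inE negbK.
Qed.

End FamilySplitting.

(** * Nonexpansiveness for one edge and for a sequence of edges *)

Section HierarchicalSoftThresholding.
Variables (R : realType) (I : finType) (H : I -> hilbertType R).
Variables (HH : tensor_product H)
  (HT : forall A : {set I}, tensor_product (@subfamily R I H A)).

(** [tensor_map] applies to elementary tensors, since the product of the inner products over all
    indices splits into those over the complement of [n] and over [n]. *)
Lemma exists_splitting_map (n : {set I}) :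
  exists tau : HT (~: n)%SET -> HT n -> HH,
    (forall u v u' v', inner (tau u v) (tau u' v') = inner u u' * inner v v') /\
    (forall x, tau (pure (HT (~: n)%SET) (restrict_family x))
                   (pure (HT n) (restrict_family x)) = pure HH x).
Proof.
have [|tau [tauI tauE]] := tensor_map (h := fun y z => pure HH (glue y z))
    (@pure_dense _ _ _ (HT (~: n)%SET)) (@pure_dense _ _ _ (HT n)).
  move=> y z y' z'; rewrite !pure_inner (prod_inner_restrict n).
  by rewrite !restrict_glue_in !restrict_glue_out.
by exists tau; split => // x; rewrite tauE glue_restrict.
Qed.

Variables (a : R) (a0 : 0 < a).

(** The three [xget] choices are first made explicit: matricization is [op], dematricization inverts
    it, and the thresholded operator is [op P] with [P] from [soft_svd]. The projection argument
    then applies. *)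
Lemma soft_edge_nonexpansive (n : {set I}) (w w' : HH) :
  `|soft_edge HT a n w - soft_edge HT a n w'| <= `|w - w'|.
Proof.
have [tau [tauI tauE]] := exists_splitting_map n.
have tau_total (z : HH) : (forall u v, inner z (tau u v) = 0) -> z = 0.
  move=> zt; apply: (dense_inner_inj (@pure_dense _ _ _ HH)) => _ [x _ <-].
  by rewrite -tauE zt inner0l.
have [op opE] := exists_pairing_op tauI.
have matE (z : HH) : matricization z = op z.
  apply: xget_unique => [|X [[Xlin Xcont _] Xz]].
    split; first exact: (op_hilbert_schmidt tauI opE).
    by move=> x; rewrite opE tauE.
  apply: (op_unique tauI opE (@pure_dense _ _ _ (HT (~: n)%SET))
    (@pure_dense _ _ _ (HT n))) => // y t.
  have := Xz (glue y t); rewrite restrict_glue_in restrict_glue_out => ->.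
  by rewrite -tauE restrict_glue_in restrict_glue_out.
have dematE z : dematricization HH (op z) = z.
  apply: xget_unique => [|z']; first exact: matE.
  by rewrite /= matE => /(op_inj tau_total opE).
have softE z : exists P, [/\ soft_edge HT a n z = P,
    spectral_ball tau a (z - P) &
    forall k, spectral_ball tau a k -> inner k P <= inner (z - P) P].
  rewrite /soft_edge matE /soft_op.
  (* The default value of [xget] never occurs, because a decomposition exists. Whichever one is
     chosen, [Y] and [op P] are limits of the same series. *)
  case: xgetP => [Y _ [s [u [v [svd expY]]]]|noY]; last first.
    have [s [u [v svd]]] := exists_svd tauI tau_total opE z.
    have [P [expP _ _]] := soft_svd tauI opE a0 svd.
    by exfalso; apply: (noY (op P)); exists s, u, v.
  have [P [expP ball cone]] := soft_svd tauI opE a0 svd.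
  have -> : Y = op P.
    by apply/funext => x; have lhs := expY x; exact: cvg_unique lhs (expP x).
  by exists P; split => //; exact: dematE.
have [P [-> ball cone]] := softE w; have [P' [-> ball' cone']] := softE w'.
exact: projection_residual_nonexpansive ball cone ball' cone'.
Qed.

Lemma hier_soft_nonexpansive (ns : seq {set I}) (w w' : HH) :
  `|hier_soft HT a ns w - hier_soft HT a ns w'| <= `|w - w'|.
Proof.
elim: ns w w' => [|n ns IH] w w'; first exact: lexx.
exact: le_trans (IH _ _) (soft_edge_nonexpansive n w w').
Qed.

End HierarchicalSoftThresholding.

Theorem proposition3p2 (R : realType) (d : nat) (hd : (2 <= d)%N)
  (H : 'I_d -> hilbertType R) (H_sep : forall i, separable_space (H i))
  (HH : tensor_product H)
  (HT : forall A : {set 'I_d}, tensor_product (@subfamily R _ H A))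
  (T : {set {set 'I_d}}) (T_tree : dimension_tree T)
  (n : (2 * d - 3).-tuple {set 'I_d}) (n_enum : edge_enumeration T n)
  (u v : HH) (alpha : R) (alpha_gt0 : 0 < alpha) :
  `|hier_soft HT alpha n u - hier_soft HT alpha n v| <= `|u - v|.
Proof. exact: hier_soft_nonexpansive. Qed.
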